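(* Let $n\ge 2$, let $a<b$ be real numbers and let $\phi:\{1,2,\ldots,n\}\to[a,b]$. For a tree $T$ on vertex set $\{1,\ldots,n\}$ define $F(T) = \sum_{\{j,k\}\in E(T)} \phi(j)\phi(k)$. Let ${\boldsymbol{x}}=(x_1,\ldots,x_n)$ be a tree degree sequence, let $\mathcal{T}_{\boldsymbol{x}}$ be the set of trees on $\{1,\ldots,n\}$ with degree sequence ${\boldsymbol{x}}$, and let $\bar F({\boldsymbol{x}}) = \frac{1}{|\mathcal{T}_{\boldsymbol{x}}|}\sum_{T\in\mathcal{T}_{\boldsymbol{x}}} F(T)$. Let \[ L_\phi = (b-a)^3 \min\big\{ (b-a) n,\; \|\phi\|_m (\ln n + 2)\big\},\qquad \|\phi\|_m = \min_{c\in\mathbb{R}} \sum_{j=1}^n |\phi(j)-c|. \] Then for $\xi\in\{-1,1\}$, \[ \frac{1}{|\mathcal{T}_{\boldsymbol{x}}|} \sum_{T\in\mathcal{T}_{\boldsymbol{x}}} e^{\xi F(T)} = \exp\left(\xi \bar{F}({\boldsymbol{x}})+ K\right) \] for some real constant $K$ with $0\leq K\leq \tfrac18 L_\phi$. Furthermore, if $\widehat T$ is a uniformly random element of $\mathcal{T}_{\boldsymbol{x}}$, then for any real $t>0$, \[ \Pr( |F(\widehat{T}) - \bar{F}({\boldsymbol{x}})| > t) \leq 2\exp\left( - 2 t^2/L_\phi \right). \]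
   Context: A tree degree sequence is a sequence $(x_1,\ldots,x_n)$ of positive integers whose entries sum to $2n-2$. *)

(* Defs.v *)
From mathcomp Require Import all_boot all_order all_algebra.
From mathcomp Require Import all_classical all_reals all_analysis.

Set Implicit Arguments.
Unset Strict Implicit.
Unset Printing Implicit Defensive.

Import Order.TTheory GRing.Theory Num.Theory.
Import numFieldNormedType.Exports.

Local Open Scope ring_scope.

Section Trees.
Variable V : finType.

(* A graph on V is given by its edge set. *)
Implicit Types (E : {set {set V}}) (x : V -> nat).

Definition simple_graph E : Prop := forall e, e \in E -> #|e| = 2.

Definition adj E : rel V := fun j k => [set j; k] \in E.

Definition graph_connected E : Prop := forall j k, connect (adj E) j k.

(* [ucycle] also accepts the empty sequence and, for an edge {j, k}, the
   sequence [:: j; k]; genuine cycles are those with at least 3 vertices. *)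
Definition acyclic E : Prop :=
  forall p : seq V, ucycle (adj E) p -> (size p <= 2)%N.

Definition is_tree E : Prop :=
  [/\ simple_graph E, graph_connected E & acyclic E].

Definition deg E (j : V) : nat := #|[set e in E | j \in e]|.

Definition trees_with_degrees x : {set {set {set V}}} :=
  [set E | `[< is_tree E /\ forall j, deg E j = x j >]].

End Trees.

Definition tree_degree_sequence (n : nat) (x : 'I_n -> nat) : Prop :=
  (forall j, 0 < x j)%N /\ (\sum_(j < n) x j = 2 * n - 2)%N.

Section Uniform.
Variables (R : realType) (T : finType).

Definition unif_mean (A : {set T}) (f : T -> R) : R :=
  #|A|%:R^-1 * \sum_(t in A) f t.

Definition unif_prob (A : {set T}) (P : pred T) : R :=
  #|[set t in A | P t]|%:R / #|A|%:R.

End Uniform.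

Section Functional.
Variables (R : realType) (n : nat) (phi : 'I_n -> R).

(* An edge e = {j, k} contributes phi j * phi k. *)
Definition F (E : {set {set 'I_n}}) : R :=
  \sum_(e in E) \prod_(j in e) phi j.

Definition Fbar (x : 'I_n -> nat) : R :=
  unif_mean (trees_with_degrees x) F.

Definition abs_dev (c : R) : R := \sum_(j < n) `|phi j - c|.

(* The infimum is a minimum: see [normm_min]. *)
Definition normm : R := inf (range abs_dev).

Definition Lphi (a b : R) : R :=
  (b - a) ^+ 3 * Num.min ((b - a) * n%:R) (normm * (ln n%:R + 2)).

Lemma abs_dev_continuous : continuous abs_dev.
Proof.
rewrite /abs_dev; elim: (index_enum _) => [|j s IH] c.
  by under eq_fun do rewrite big_nil; exact: cvg_cst.
under eq_fun do rewrite big_cons.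
apply: cvgD; last exact: IH.
by apply: cvg_norm; apply: cvgB; [exact: cvg_cst | exact: cvg_id].
Qed.

Lemma normm_le c : normm <= abs_dev c.
Proof.
apply: ge_inf; last by exists c.
by exists 0 => _ [d _ <-]; apply: sumr_ge0.
Qed.

Lemma normm_min : exists c, normm = abs_dev c /\ forall d, abs_dev c <= abs_dev d.
Proof.
pose M := \sum_(j < n) `|phi j|.
have M0 : 0 <= M by apply: sumr_ge0.
have hM j : - M <= phi j <= M.
  by rewrite -ler_norml /M (bigD1 j) //= lerDl sumr_ge0.
have NM : - M <= M by rewrite (le_trans _ M0) // oppr_le0.
have [c _ hc] := EVT_min NM (continuous_subspaceT abs_dev_continuous).
have {}hc d : abs_dev c <= abs_dev d.
  have le_d d' : (forall j, `|phi j - d'| <= `|phi j - d|) ->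
      d' \in `[- M, M] -> abs_dev c <= abs_dev d.
    by move=> le_d' /hc /le_trans; apply; apply: ler_sum => j _.
  have [dM|Md] := leP d (- M).
    apply: (le_d (- M)) => [j|]; last by rewrite in_itv /= lexx NM.
    have /andP[h _] := hM j.
    rewrite !ger0_norm ?subr_ge0 ?(le_trans dM) //.
    by rewrite lerB.
  have [dM|Md'] := leP d M.
    by apply: (le_d d) => //; rewrite in_itv /= (ltW Md) dM.
  apply: (le_d M) => [j|]; last by rewrite in_itv /= lexx NM.
  have /andP[_ h] := hM j.
  rewrite !ler0_norm ?subr_le0 ?(le_trans h (ltW Md')) //.
  by rewrite lerN2 lerB // ltW.
exists c; split=> //; apply/eqP; rewrite eq_le normm_le /=.
by apply: lb_le_inf; [exists (abs_dev 0), 0 | move=> _ [d _ <-]].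
Qed.

End Functional.

(* Main.v *)
Require Import Defs.
From mathcomp Require Import all_boot all_order all_algebra.
From mathcomp Require Import all_classical all_reals all_analysis.
(* Imported again so that [setP], [subsetP], ... are those of finite sets. *)
From mathcomp Require Import fintype finset.
From mathcomp Require Import ring lra.

Set Implicit Arguments.
Unset Strict Implicit.
Unset Printing Implicit Defensive.

Import Order.TTheory GRing.Theory Num.Theory.
Import numFieldNormedType.Exports.

Local Open Scope ring_scope.

(** Reveal a uniformly random tree with degrees y j + 1 on a vertex set U by
    repeatedly removing a leaf v. Its neighbour is u with probability
    y u / (#|U| - 2), and what remains is a uniformly random tree on U \ v with
    y u decreased by one. The conditional means of F have a closed form, and for
    two candidate neighbours u, u' they differ by
      (phi u - phi u') * (phi v - average of phi over U \ {v, u, u'}).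
    This is at most (b - a)^2 in absolute value, and also at most (b - a) times
    |phi v - c| + (sum over U \ v of |phi - c|) / (#|U| - 3). Hoeffding's lemma
    for each removal then bounds the moment generating function of F by
    exp (z * mean + z^2 L / 8), where the harmonic sum of the second bound
    produces the factor ln n + 2. The lower bound on K is Jensen's inequality,
    and the tail bound is Chernoff's. *)

(** * Hoeffding's lemma for finitely supported laws *)

Section Hoeffding.
Variable R : realType.
Implicit Types (p h t : R).

Lemma nondecreasing_is_derive (f df : R -> R) :
  (forall t, is_derive t 1 f (df t)) -> (forall t, 0 <= t -> 0 <= df t) ->
  forall h, 0 <= h -> f 0 <= f h.
Proof.
move=> fE df0 h h0.
have fd t : derivable f t 1 by case: (fE t).
apply: (@ger0_derive1_ndecry _ f 0) => // [t|].
  rewrite in_itv /= andbT => /ltW t0; rewrite derive1E.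
  by rewrite (@derive_val _ _ _ _ _ _ _ (fE t)) df0.
apply/continuous_subspaceT => t.
exact/differentiable_continuous/derivable1_diffP.
Qed.

(** The logarithmic gap [f] vanishes at 0 together with its first derivative, and its second
    derivative is [1/4 - q (1 - q) = (q - 1/2)^2], where [q t] is the exponentially tilted weight of
    the upper point. Two monotonicity arguments on the nonnegative half-line then suffice. *)
Lemma two_point_mgf_ge0 p h : 0 <= p <= 1 -> 0 <= h ->
  1 - p + p * expR h <= expR (p * h + h ^+ 2 / 8).
Proof.
case/andP=> p0 p1 h0.
pose D t := 1 - p + p * expR t.
have D0 t : 0 < D t.
  have := expR_gt0 t; rewrite /D; set e := expR t => e0.
  have [->|p'] := eqVneq p 1; first by lra.
  have : p < 1 by rewrite lt_neqAle p' p1.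
  by have := mulr_ge0 p0 (ltW e0); lra.
have DD t : is_derive t 1 D (p * expR t).
  rewrite /D; apply: is_derive_eq; rewrite /GRing.scale /=; ring.
pose q t := p * expR t / D t.
have qD t : is_derive t 1 (fun t => t / 4 + p - q t) (4^-1 - q t * (1 - q t)).
  have := @is_deriveV _ D t _ 1 (lt0r_neq0 (D0 t)) (DD t) => DV.
  rewrite /q; apply: is_derive_eq.
  rewrite /GRing.scale /=; have := D0 t; rewrite /D.
  set e := expR t => De; field.
  by apply: lt0r_neq0.
have q0 t : 0 <= t -> 0 <= t / 4 + p - q t.
  move=> t0; have -> : 0 = 0 / 4 + p - q 0.
    by rewrite /q /D expR0 mulr1 subrK divr1 mul0r add0r subrr.
  apply: (nondecreasing_is_derive qD) t0 => s _.
  by have := sqr_ge0 (q s - 2^-1); lra.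
pose f t := p * t + t ^+ 2 / 8 - ln (D t).
have fD t : is_derive t 1 f (t / 4 + p - q t).
  have := is_derive1_ln (D0 t) => lnD.
  have := @is_derive1_comp _ _ D t _ _ lnD (DD t) => lnDD.
  rewrite /f; apply: is_derive_eq.
  rewrite /GRing.scale /= /q; field.
  by apply: lt0r_neq0.
have := nondecreasing_is_derive fD q0 h0.
rewrite {1}/f {1}/D expR0 mulr1 subrK ln1 mulr0 expr0n /= mul0r subr0 addr0.
rewrite subr_ge0 -ler_expR lnK // posrE; exact: D0.
Qed.

(** A negative [h] is reduced to the previous case by swapping the two points: [p] becomes [1 - p],
    [h] becomes [- h], and both sides are rescaled by [expR h]. *)
Lemma two_point_mgf p h : 0 <= p <= 1 ->
  1 - p + p * expR h <= expR (p * h + h ^+ 2 / 8).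
Proof.
move=> /[dup] p01 /andP[p0 p1]; have [|h0] := leP 0 h; first exact: two_point_mgf_ge0.
have p01' : 0 <= 1 - p <= 1 by lra.
have h0' : 0 <= - h by lra.
have := two_point_mgf_ge0 p01' h0'.
rewrite -(ler_pM2l (expR_gt0 h)) -expRD.
rewrite (_ : h + _ = p * h + h ^+ 2 / 8); last by field.
apply: le_trans; rewrite expRN le_eqVlt; apply/orP; left; apply/eqP; field.
by rewrite gt_eqF ?expR_gt0.
Qed.

(** Convexity: the tangent at [z * t] lies below the exponential at both endpoints, and the
    barycentric weights average the two tangent values to exactly [expR (z * t)]. *)
Lemma expR_chord (z al be t : R) : al < be -> al <= t <= be ->
  expR (z * t) <= (be - t) / (be - al) * expR (z * al)
                  + (t - al) / (be - al) * expR (z * be).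
Proof.
move=> ab /andP[alt tbe]; have d0 : 0 < be - al by rewrite subr_gt0.
have tan s : expR (z * t) * (1 + (z * s - z * t)) <= expR (z * s).
  have -> : expR (z * s) = expR (z * t) * expR (z * s - z * t).
    by rewrite -expRD; congr expR; ring.
  by rewrite ler_pM2l ?expR_gt0 // expR_ge1Dx.
have w1 : 0 <= (be - t) / (be - al) by rewrite divr_ge0 ?subr_ge0 // ltW.
have w2 : 0 <= (t - al) / (be - al) by rewrite divr_ge0 ?subr_ge0 // ltW.
apply: le_trans (lerD (ler_wpM2l w1 (tan al)) (ler_wpM2l w2 (tan be))).
rewrite le_eqVlt; apply/orP; left; apply/eqP.
by field; apply: lt0r_neq0.
Qed.

(** The chord between the extreme values of [g] reduces the claim to a two-point law with the same
    mean. Extremes are taken over indices of positive weight, because in the application only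
    genuine candidate neighbours can be compared. *)
Lemma hoeffding (I : finType) (w g : I -> R) (z d : R) :
  (forall i, 0 <= w i) -> \sum_i w i = 1 ->
  (forall i j, 0 < w i -> 0 < w j -> (g i - g j) ^+ 2 <= d) ->
  \sum_i w i * expR (z * g i) <=
  expR (z * \sum_i w i * g i + z ^+ 2 * d / 8).
Proof.
move=> w0 w1 gd.
have [i0 wi0] : exists i, 0 < w i.
  apply/existsP; apply: contraTT isT => /existsPn h.
  have := oner_neq0 R; rewrite -w1 big1 ?eqxx // => i _.
  by apply/eqP; rewrite eq_le w0 leNgt h.
have [k wk kmin] := @arg_minP _ R I i0 (fun i => 0 < w i) g wi0.
have [l wl lmax] := @arg_maxP _ R I i0 (fun i => 0 < w i) g wi0.
set mu := \sum_i w i * g i.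
have gE (f1 f2 : I -> R) : (forall i, 0 < w i -> f1 i <= f2 i) ->
    \sum_i w i * f1 i <= \sum_i w i * f2 i.
  move=> h; apply: ler_sum => i _; have := w0 i; rewrite le_eqVlt.
  by case/predU1P => [<-|wi]; rewrite ?mul0r // ler_pM2l // h.
have wC c : \sum_i w i * c = c by rewrite -mulr_suml w1 mul1r.
have muk : g k <= mu by rewrite -[leLHS]wC; exact: gE.
have mul : mu <= g l by rewrite -[leRHS]wC; exact: gE.
have kl2 : z ^+ 2 * (g l - g k) ^+ 2 / 8 <= z ^+ 2 * d / 8.
  by rewrite ler_pM2r ?invr_gt0 // ler_wpM2l ?sqr_ge0 // gd.
apply: (@le_trans _ _ (expR (z * mu + z ^+ 2 * (g l - g k) ^+ 2 / 8))); last first.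
  by rewrite ler_expR lerD2l.
(* When [g] is constant on the support the chord degenerates, and both sides equal
   [expR (z * mu)]. *)
have [gkl'|gkl'] := eqVneq (g k) (g l).
  rewrite gkl' subrr expr0n mulr0 mul0r addr0 -[leRHS]wC; apply: gE => i wi.
  have -> : g i = mu; last by [].
  have h1 : g k <= g i := kmin i wi.
  have h2 : g i <= g l := lmax i wi.
  by apply/le_anti; rewrite (le_trans h2) -?gkl' //= (le_trans _ h1) // gkl'.
have klt : g k < g l by rewrite lt_neqAle gkl' kmin.
have d0 : 0 < g l - g k by rewrite subr_gt0.
pose p := (mu - g k) / (g l - g k).
have p01 : 0 <= p <= 1.
  by rewrite /p divr_ge0 ?subr_ge0 ?(ltW klt) //= ler_pdivrMr // mul1r lerB.
apply: (@le_trans _ _ (\sum_i w i * ((g l - g i) / (g l - g k) * expR (z * g k)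
   + (g i - g k) / (g l - g k) * expR (z * g l)))).
  by apply: gE => i wi; apply: expR_chord => //; rewrite kmin //; exact: lmax.
have -> : \sum_i w i * ((g l - g i) / (g l - g k) * expR (z * g k)
   + (g i - g k) / (g l - g k) * expR (z * g l)) =
   expR (z * g k) * (1 - p + p * expR (z * (g l - g k))).
  have eh : expR (z * g k) * expR (z * (g l - g k)) = expR (z * g l).
    by rewrite -expRD; congr expR; ring.
  rewrite mulrDr mulrCA eh.
  transitivity (\sum_i ((w i * g l - w i * g i) * (expR (z * g k) / (g l - g k))
     + (w i * g i - w i * g k) * (expR (z * g l) / (g l - g k)))).
    by apply: eq_bigr => i _; ring.
  rewrite big_split /= -!mulr_suml !big_split /= !sumrN !wC -/mu /p.
  by field; rewrite lt0r_neq0.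
apply: (le_trans (ler_wpM2l (expR_ge0 _) (two_point_mgf (z * (g l - g k)) p01))).
rewrite -expRD ler_expR le_eqVlt; apply/orP; left; apply/eqP.
by rewrite /p; field; rewrite lt0r_neq0.
Qed.
End Hoeffding.

(** * Trees on a subset of the vertices, and removal of a leaf *)

Section TreesOn.
Variable V : finType.
Implicit Types (E : {set {set V}}) (U : {set V}) (y : V -> nat) (u v : V).

Definition tree_on U E : Prop :=
  [/\ forall e, e \in E -> #|e| = 2 /\ e \subset U,
      {in U &, forall j k, connect (adj E) j k} & acyclic E].

(* Degrees are recorded as [y j = deg j - 1], the number of occurrences of [j]
   in the Pruefer code. *)
Definition trees_on U y : {set {set {set V}}} :=
  [set E | `[< tree_on U E /\ {in U, forall j, deg E j = (y j).+1} >]].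

Definition decr_at y u : V -> nat := fun j => (y j - (j == u))%N.

Lemma adj_sym E : symmetric (adj E).
Proof. by move=> j k; rewrite /adj setUC. Qed.

Lemma connect_adj_sym E : connect_sym (adj E).
Proof. by apply: sym_connect_sym; exact: adj_sym. Qed.

Lemma tree_on_adj U E j k : tree_on U E -> adj E j k ->
  [/\ j \in U, k \in U & j != k].
Proof.
case=> sE _ _ /sE[]; rewrite cards2 => jk; rewrite subUset !sub1set.
by case/andP=> jU kU; split=> //; move: jk; case: eqP.
Qed.

Lemma acyclic_sub E E' : E' \subset E -> acyclic E -> acyclic E'.
Proof.
move=> /subsetP sE' aE p /andP[cp up]; apply: aE.
rewrite /ucycle up andbT; case: p cp {up} => //= j p.
by apply: sub_path => k l; exact: sE'.
Qed.

Lemma deg_setU1 E j k l : [set j; k] \notin E ->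
  deg ([set j; k] |: E) l = (((l == j) || (l == k)) + deg E l)%N.
Proof.
move=> jkE; rewrite /deg; set b := _ || _.
have [ljk|/negPf ljk] := boolP b.
  rewrite (_ : [set e in [set j; k] |: E | l \in e] =
             [set j; k] |: [set e in E | l \in e]); last first.
    apply/setP => e; rewrite !inE; case: eqP => //= ->.
    by rewrite !inE.
  by rewrite cardsU1 inE (negPf jkE).
apply: eq_card => e; rewrite !inE.
by case: eqP => //= ->; rewrite !inE -/b ljk andbF.
Qed.

Lemma tree_on_set1 v : tree_on [set v] set0.
Proof.
split=> [e|j k|p]; rewrite ?inE //.
  by move=> /eqP-> /eqP->; exact: connect0.
case: p => [|j p] //= /andP[] /=.
by case: p => [|k p] /=; rewrite /adj inE.
Qed.

Section Leaf.
Variables (U : {set V}) (v u : V).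
Hypotheses (vU : v \in U) (uU : u \in U) (uv : u != v).

Lemma tree_on_add_leaf E : tree_on (U :\ v) E -> tree_on U ([set v; u] |: E).
Proof.
move=> tE; have [sE cE aE] := tE; set E1 := _ |: E.
have vN j : adj E v j = false.
  by apply/negP => /(tree_on_adj tE)[]; rewrite !inE eqxx.
have adjE1 j k : v != j -> v != k -> adj E1 j k = adj E j k.
  move=> vj vk; rewrite /adj /E1 2!inE; case: eqP => //= /setP /(_ v).
  by rewrite !inE eqxx (negPf vj) (negPf vk).
have adjv j : adj E1 v j = (j == u).
  apply/idP/eqP => [|->]; last by rewrite /adj !inE eqxx.
  rewrite /adj /E1 inE -/(adj E v j) vN orbF inE => /eqP /setP /(_ u).
  by rewrite !inE eqxx orbT (negPf uv) => /eqP.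
have cE1 j : j \in U -> connect (adj E1) u j.
  move=> jU; have [->|jv] := eqVneq j v.
    by apply: connect1; rewrite adj_sym adjv.
  have : connect (adj E) u j by apply: cE; rewrite !inE ?uv ?jv.
  apply: connect_sub => k l kl; apply: connect1; rewrite adjE1 //.
    by apply/eqP => vk; rewrite -vk vN in kl.
  by apply/eqP => vl; rewrite adj_sym -vl vN in kl.
split.
- move=> e; rewrite /E1 !inE => /predU1P[->|/sE[-> /subset_trans]].
    by rewrite cards2 eq_sym uv subUset !sub1set vU uU.
  by move=> h; split=> //; apply: h; exact: subD1set.
- move=> j k jU kU; apply: connect_trans (cE1 _ kU).
  by rewrite connect_adj_sym; exact: cE1.
- move=> p cp; have [vp|vNp] := boolP (v \in p); last first.
    apply: aE; case/andP: cp => cp up; rewrite /ucycle up andbT.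
    have pE : {in mem p &, adj E1 =2 adj E}.
      by move=> j k jp kp; apply: adjE1; apply: contraNneq vNp => ->.
    by rewrite -(eq_in_cycle pE) //; apply/allP.
  (* Rotate the cycle to start at [v]: its second and its last vertex are both neighbours of [v],
     hence both [u], so distinctness leaves at most two vertices. *)
  have [i q rq] := rot_to vp; rewrite -(size_rot i) rq.
  move: cp; rewrite -(rot_ucycle i) rq => /andP[] /=.
  case: q {rq} => [|j q] //; rewrite /= adjv rcons_path => /and3P[/eqP-> _].
  rewrite adj_sym adjv => /eqP lq /and3P[_ uq _].
  by case: q lq uq => //= k q <-; rewrite mem_last.
Qed.

Lemma tree_on_rem_leaf E : tree_on U E -> deg E v = 1%N -> [set v; u] \in E ->
  tree_on (U :\ v) (E :\ [set v; u]).
Proof.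
move=> tE dv vuE; have [sE cE aE] := tE; set E1 := E :\ _.
have vN e : e \in E1 -> v \notin e.
  rewrite !inE => /andP[evu eE]; apply/negP => ve.
  have : [set [set v; u]; e] \subset [set e in E | v \in e].
    by rewrite subUset !sub1set !inE vuE eE ve eqxx.
  by move/subset_leq_card; rewrite cards2 eq_sym evu -/(deg E v) dv.
(* Retracting [v] onto [u] collapses the removed edge and fixes all others, so walks in [E] project
   to walks avoiding [v]. *)
pose r j := if j == v then u else j.
have vu j : adj E v j -> j = u.
  move=> vj; have [/eqP|h] := eqVneq [set v; j] [set v; u].
    move=> /eqP /setP /(_ u); rewrite !inE eqxx orbT (negPf uv).
    by move/eqP.
  by have := vN [set v; j]; rewrite !inE h eqxx; move/(_ vj).
have rE j k : adj E j k -> connect (adj E1) (r j) (r k).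
  rewrite /r; case: eqVneq => [->|jv].
    by move=> /vu ->; rewrite (negPf uv) connect0.
  case: eqVneq => [->|kv].
    by rewrite adj_sym => /vu ->; rewrite connect0.
  move=> jk; apply: connect1; rewrite /adj !inE -/(adj E j k) jk andbT.
  apply/eqP => /setP /(_ v); rewrite !inE eqxx /=.
  by rewrite eq_sym (negPf jv) eq_sym (negPf kv).
have rC j k : connect (adj E) j k -> connect (adj E1) (r j) (r k).
  case/connectP => p; elim: p j => [|l p IH] j /=; first by move=> _ ->.
  by case/andP=> /rE jl /IH h /h; exact: connect_trans.
split.
- move=> e eE1; have := eE1; rewrite inE => /andP[_ /sE[ce /subsetP eU]].
  split=> //; apply/subsetP => j je; rewrite !inE eU // andbT.
  by apply: contraTneq je => ->; exact: vN.
- move=> j k; rewrite !inE => /andP[jv jU] /andP[kv kU].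
  by have := rC j k (cE _ _ jU kU); rewrite /r (negPf jv) (negPf kv).
- by apply: acyclic_sub aE; exact: subD1set.
Qed.
End Leaf.

Lemma tree_on_deg_gt0 U E j : tree_on U E -> (1 < #|U|)%N -> j \in U ->
  (0 < deg E j)%N.
Proof.
move=> [sE cE aE] /card_gt1P[k [l [kU lU kl]]] jU.
have [m mU mj] : exists2 m, m \in U & m != j.
  by have [kj|] := eqVneq k j; [exists l; rewrite // -kj eq_sym | exists k].
case/connectP: (cE j m jU mU) => [[_ mj'|i p /=]].
  by rewrite mj' eqxx in mj.
case/andP=> ji _ _; rewrite /deg card_gt0; apply/set0Pn; exists [set j; i].
by rewrite !inE eqxx /= andbT.
Qed.

Lemma trees_onP U y E : reflect
  (tree_on U E /\ {in U, forall j, deg E j = (y j).+1}) (E \in trees_on U y).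
Proof. by rewrite inE; exact: asboolP. Qed.

Lemma edge_notin U E v u : tree_on (U :\ v) E -> [set v; u] \notin E.
Proof.
case=> sE _ _; apply/negP => /sE[_]; rewrite subUset !sub1set => /andP[].
by rewrite !inE eqxx.
Qed.

(** The two side conditions make the correspondence exact: [[set v; u] \notin E] lets the added edge
    be taken away again, and [0 < y u] excludes the case where the subtraction in [decr_at]
    truncates. *)
Lemma trees_on_setU1 U y v u E : v \in U -> y v = 0%N -> (2 < #|U|)%N ->
  u \in U :\ v ->
  ([set v; u] |: E \in trees_on U y) && ([set v; u] \notin E) =
  (E \in trees_on (U :\ v) (decr_at y u)) && (0 < y u)%N.
Proof.
move=> vU yv U2 uUv; have := uUv; rewrite 2!inE => /andP[uv uU].
apply/andP/andP => [[/trees_onP[tE dE] vuE]|[/trees_onP[tE dE] yu]].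
  have tE1 : tree_on (U :\ v) E.
    rewrite -(setU1K vuE); apply: tree_on_rem_leaf => //.
      by rewrite dE // yv.
    by rewrite !inE eqxx.
  (* At least two vertices remain after removing [v], so [u] keeps a neighbour and its degree in the
     larger tree is at least 2. *)
  have yu : (0 < y u)%N.
    have : (0 < deg E u)%N.
      apply: tree_on_deg_gt0 tE1 _ uUv.
      by move: U2; rewrite (cardsD1 v U) vU.
    have := dE u uU; rewrite deg_setU1 // eqxx orbT add1n.
    by case: (y u) => // -[->].
  split=> //; apply/trees_onP; split=> // j; rewrite !inE => /andP[jv jU].
  have := dE j jU; rewrite deg_setU1 // (negPf jv) /= /decr_at.
  case: eqVneq => [->|_]; last by rewrite subn0.
  by rewrite add1n; case: (y u) yu => // k _ [->]; rewrite subn1.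
split; last exact: edge_notin tE.
apply/trees_onP; split; first exact: tree_on_add_leaf.
move=> j jU; rewrite deg_setU1; last exact: edge_notin tE.
have [->|jv] := eqVneq j v.
  rewrite /= yv; case: (tE) => sE _ _; rewrite /deg.
  apply/eqP; rewrite eqSS cards_eq0; apply/eqP/setP => e; rewrite !inE.
  by apply/negP => /andP[/sE[_ /subsetP h] /h]; rewrite !inE eqxx.
rewrite dE ?inE ?jv // /decr_at; case: eqVneq => [->|_] /=.
  by case: (y u) yu => // k _; rewrite subn1.
by rewrite subn0.
Qed.

(** Stated as a boolean equation in [w] so that a sum over possible neighbours collapses to one
    term. *)
Lemma leaf_nbr U y v E : v \in U -> y v = 0%N -> E \in trees_on U y ->
  exists2 u, u \in U :\ v &
    forall w, (w \in U :\ v) && ([set v; w] \in E) = (w == u).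
Proof.
move=> vU yv /trees_onP[tE /(_ v vU)]; rewrite yv /deg => /eqP/cards1P[e eP].
have := set11 e; rewrite -eP inE => /andP[eE ve].
have [sE _ _] := tE; have [/eqP/cards2P[j [k [jk ejk]]] /subsetP eU] := sE e eE.
wlog vj : j k jk ejk / v = j.
  move=> wl; have := ve; rewrite {1}ejk !inE => /orP[]/eqP; first exact: (wl j k).
  by move=> vk; apply: (wl k j) => //; [rewrite eq_sym | rewrite setUC].
subst j; exists k; first by rewrite !inE eq_sym jk eU // ejk !inE eqxx orbT.
move=> w; apply/andP/eqP => [[wU vwE]|->]; last first.
  by rewrite -ejk eE !inE eq_sym jk eU // ejk !inE eqxx orbT.
have : [set v; w] \in [set e in E | v \in e] by rewrite !inE vwE eqxx.
rewrite eP inE ejk => /eqP/setP/(_ w); rewrite !inE eqxx orbT.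
by move: wU; rewrite !inE => /andP[/negPf-> _] /esym/eqP.
Qed.

(** Double counting: each tree has exactly one edge at the leaf [v], so summing over that edge
    changes nothing; after exchanging sums, deleting the edge reindexes by the smaller trees. *)
Lemma sum_trees_on_leaf (M : nmodType) U y v (G : {set {set V}} -> M) :
  v \in U -> y v = 0%N -> (2 < #|U|)%N ->
  \sum_(E in trees_on U y) G E =
  \sum_(u in U | (0 < y u)%N)
     \sum_(E in trees_on (U :\ v) (decr_at y u)) G ([set v; u] |: E).
Proof.
move=> vU yv U2.
transitivity (\sum_(E in trees_on U y)
    \sum_(u in U :\ v | [set v; u] \in E) G E).
  apply: eq_bigr => E ET; have [u uU uP] := leaf_nbr vU yv ET.
  by rewrite (eq_bigl _ _ uP) big_pred1_eq.
rewrite (exchange_big_dep (fun u => u \in U :\ v)) //=; last by move=> E u _ /andP[].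
transitivity (\sum_(u in U :\ v)
    \sum_(E in trees_on (U :\ v) (decr_at y u) | (0 < y u)%N)
     G ([set v; u] |: E)).
  apply: eq_bigr => u uU.
  rewrite (reindex_onto (fun E => [set v; u] |: E) (fun E => E :\ [set v; u])) /=.
    apply: eq_bigl => E; rewrite -(trees_on_setU1 _ vU yv U2 uU) uU /= setU11 andbT.
    congr andb; apply/eqP/idP => [<-|/setU1K //]; first by rewrite !inE eqxx.
  by move=> E /andP[_ /andP[_ h]]; rewrite setD1K.
rewrite [RHS](eq_bigl (fun u => (u \in U :\ v) && (0 < y u)%N)); last first.
  by move=> u; rewrite !inE; case: eqVneq => [->|//]; rewrite yv andbF.
rewrite [RHS]big_mkcondr; apply: eq_bigr => u uU.
case: (ltnP 0 (y u)) => yu; first by apply: eq_bigl => E; rewrite andbT.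
by apply: big_pred0 => E; rewrite andbF.
Qed.

Lemma trees_on2 U y : #|U| = 2 -> {in U, forall j, y j = 0%N} ->
  trees_on U y = [set [set U]].
Proof.
move=> U2 y0; have [v [u [vu UE]]] := cards2P _ (introT eqP U2).
have vU : v \in U by rewrite UE !inE eqxx.
have uU : u \in U by rewrite UE !inE eqxx orbT.
apply/setP => E; rewrite [RHS]inE; apply/trees_onP/eqP => [[[sE _ _] dE]|->].
  apply/setP => e; rewrite inE.
  have h e' : e' \in E -> e' = U.
    by move=> /sE[ce' eU']; apply/eqP; rewrite eqEcard eU' ce' U2.
  apply/idP/eqP => [/h //|->].
  have : (0 < deg E v)%N by rewrite dE.
  by rewrite /deg card_gt0 => /set0Pn[e']; rewrite inE => /andP[e'E _]; rewrite -(h e').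
split.
  have -> : [set U] = [set v; u] |: set0 by rewrite setU0 UE.
  apply: tree_on_add_leaf => //; first by rewrite eq_sym.
  rewrite (_ : U :\ v = [set u]); first exact: tree_on_set1.
  by rewrite UE setU1K // inE.
move=> j jU; rewrite y0 // /deg (_ : [set e in _ | _] = [set U]) ?cards1 //.
by apply/setP => e; rewrite !inE; case: eqP => //= ->.
Qed.

(** The equation [sum y + 2 = #|U|] is the degree-sum condition of a tree in terms of [y]. Removing
    [v] lowers both sides by one, so it is an invariant of the recursion. *)
Lemma sum_decr_at U y v u : v \in U -> y v = 0%N -> u \in U -> (0 < y u)%N ->
  (\sum_(j in U) y j + 2 = #|U|)%N ->
  (\sum_(j in U :\ v) decr_at y u j + 2 = #|U :\ v|)%N.
Proof.
move=> vU yv uU yu yU.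
have cU : #|U| = #|U :\ v|.+1 by rewrite (cardsD1 v U) vU.
have uv : u != v by apply: contraTneq yu => ->; rewrite yv.
apply/succn_inj; rewrite -cU -yU -addSn; congr (_ + 2)%N.
rewrite [in RHS](bigD1 v) //= yv add0n.
rewrite [in RHS](bigD1 u) /=; last by rewrite uU.
rewrite (bigD1 u) /=; last by rewrite !inE uv.
rewrite {1}/decr_at eqxx -addSn subn1 prednK //; congr addn.
apply: eq_big => j; first by rewrite !inE; case: (j == v); rewrite ?andbT ?andbF.
by case/andP=> _ /negPf ju; rewrite /decr_at ju subn0.
Qed.

(* Peeling off leaves: a vertex [v] with [y v = 0] exists because the [y j] sum
   to less than the number of vertices. *)
Lemma leaf_ind (P : {set V} -> (V -> nat) -> Prop) :
  (forall U y, #|U| = 2 -> {in U, forall j, y j = 0%N} -> P U y) ->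
  (forall U y v, v \in U -> y v = 0%N -> (2 < #|U|)%N ->
     (\sum_(j in U) y j + 2 = #|U|)%N ->
     (forall u, u \in U -> (0 < y u)%N -> P (U :\ v) (decr_at y u)) -> P U y) ->
  forall U y, (\sum_(j in U) y j + 2 = #|U|)%N -> P U y.
Proof.
move=> P2 PS U; have [m] := ubnP #|U|; elim: m U => // m IH U Um y yU.
have [U2|U2] := leqP #|U| 2.
  apply: P2 => [|j jU]; first by apply/eqP; rewrite eqn_leq U2 -yU leq_addl.
  move: U2; rewrite -yU -{2}[2%N]add0n leq_add2r leqn0 sum_nat_eq0.
  by move/forall_inP/(_ j jU)/eqP.
have [v vU yv] : exists2 v, v \in U & y v = 0%N.
  have [v /andP[vU /eqP yv]|h] := pickP (fun v => (v \in U) && (y v == 0%N)).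
    by exists v.
  have : (\sum_(j in U) 1 <= \sum_(j in U) y j)%N.
    by apply: leq_sum => j jU; have := h j; rewrite jU; case: (y j).
  by rewrite sum1_card -yU -[leqRHS]addn0 leq_add2l.
have cU : #|U| = #|U :\ v|.+1 by rewrite (cardsD1 v U) vU.
apply: (PS U y v) => // u uU yu; apply: IH; first by rewrite -ltnS -cU.
exact: sum_decr_at.
Qed.

End TreesOn.

(** * Counting trees, and averaging by conditioning on the neighbour of a leaf *)

Section LeafRecursion.
Variables (R : realType) (V : finType).
Implicit Types (U : {set V}) (y : V -> nat) (u v : V).

(** The multinomial coefficient counting Pruefer codes of length [#|U| - 2] in which each [j] occurs
    [y j] times. *)
Definition pruefer_count U y : R :=
  (#|U| - 2)`!%:R / \prod_(j in U) (y j)`!%:R.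

(** Extended by zero outside [U], so that it is a probability vector on the whole type, as
    [hoeffding] expects. *)
Definition leaf_weight U y u : R :=
  if u \in U then (y u)%:R / (#|U| - 2)%:R else 0.

Lemma pruefer_count_gt0 U y : 0 < pruefer_count U y.
Proof.
rewrite divr_gt0 ?ltr0n ?fact_gt0 //.
by apply: prodr_gt0 => j _; rewrite ltr0n fact_gt0.
Qed.

Lemma leaf_weight_ge0 U y u : 0 <= leaf_weight U y u.
Proof. by rewrite /leaf_weight; case: ifP => // _; rewrite divr_ge0. Qed.

Lemma leaf_weight_gt0 U y u : 0 < leaf_weight U y u -> u \in U /\ (0 < y u)%N.
Proof.
rewrite /leaf_weight; case: ifP => uU; last by rewrite ltxx.
by case: (y u) => //; rewrite mul0r ltxx.
Qed.

Lemma cardsD1_subn2 U v : v \in U -> (2 < #|U|)%N ->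
  (#|U| - 2 = (#|U :\ v| - 2).+1)%N.
Proof.
move=> vU; rewrite (cardsD1 v U) vU /= add1n ltnS => U2.
by rewrite subSn.
Qed.

Lemma sum_leaf_weight U y : (2 < #|U|)%N -> (\sum_(j in U) y j + 2 = #|U|)%N ->
  \sum_u leaf_weight U y u = 1.
Proof.
move=> U2 yU; rewrite -big_mkcond /= -mulr_suml -natr_sum -yU addnK divff //.
by rewrite pnatr_eq0 -lt0n -(ltn_add2r 2) yU.
Qed.

Section Step.
Variables (U : {set V}) (y : V -> nat) (v : V).
Hypotheses (vU : v \in U) (yv : y v = 0%N) (U2 : (2 < #|U|)%N).
Hypothesis yU : (\sum_(j in U) y j + 2 = #|U|)%N.

Lemma nleaf u : (0 < y u)%N -> u != v.
Proof. by apply: contraTneq => ->; rewrite yv. Qed.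

Lemma big_decr (A : nmodType) (f : V -> nat -> A) u :
  u \in U -> (0 < y u)%N ->
  \sum_(j in U :\ v) f j (decr_at y u j) =
    f u (y u).-1 + \sum_(j in U :\ v :\ u) f j (y j).
Proof.
move=> uU yu; rewrite (big_setD1 u) /=; last by rewrite !inE nleaf.
congr (_ + _); first by rewrite /decr_at eqxx subn1.
by apply: eq_bigr => j; rewrite 2!inE /decr_at => /andP[/negPf-> _]; rewrite subn0.
Qed.

(** Lowering both [#|U| - 2] and [y u] by one scales the multinomial coefficient by their ratio;
    this identifies [leaf_weight] as the law of the neighbour of [v]. *)
Lemma pruefer_count_decr u : u \in U -> (0 < y u)%N ->
  pruefer_count (U :\ v) (decr_at y u) = pruefer_count U y * leaf_weight U y u.
Proof.
move=> uU yu; have uv := nleaf yu.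
rewrite /pruefer_count /leaf_weight uU (cardsD1_subn2 vU U2) factS natrM.
rewrite [in RHS](big_setD1 v) //= yv mul1r.
have uUv : u \in U :\ v by rewrite !inE uv.
rewrite !(big_setD1 u uUv) /= {1}/decr_at eqxx subn1.
rewrite (eq_bigr (fun j => (y j)`!%:R)); last first.
  by move=> j; rewrite 2!inE /decr_at => /andP[/negPf-> _]; rewrite subn0.
set p := \prod_(j in _) _.
have p0 : p != 0 by apply/prodf_neq0 => j _; rewrite pnatr_eq0 -lt0n fact_gt0.
case: (y u) yu => // k _; rewrite [in RHS]factS natrM /=.
field; rewrite p0 !pnatr_eq0 -?lt0n ?fact_gt0 /=.
by rewrite !nat1r !pnatr_eq0.
Qed.
End Step.

(** By the leaf recursion the count is multiplied by the total leaf weight, which is 1. *)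
Lemma card_trees_on U y : (\sum_(j in U) y j + 2 = #|U|)%N ->
  #|trees_on U y|%:R = pruefer_count U y.
Proof.
move: U y; apply: leaf_ind => [U y U2 y0|U y v vU yv U2 yU IH].
  rewrite trees_on2 // cards1 /pruefer_count U2 big1 ?divr1 // => j jU.
  by rewrite y0.
rewrite -sum1_card natr_sum (sum_trees_on_leaf _ vU yv U2).
under eq_bigr => u /andP[uU yu].
  rewrite -natr_sum sum1_card IH // (pruefer_count_decr vU yv U2 uU yu); over.
rewrite -mulr_sumr -[RHS]mulr1 -(sum_leaf_weight U2 yU); congr (_ * _).
rewrite big_mkcond /=; apply: eq_bigr => u _; rewrite /leaf_weight.
by case: (u \in U) => //=; case: (y u) => //; rewrite mul0r.
Qed.

(** The law of total expectation, conditioning on the neighbour [u] of the leaf [v]. *)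
Lemma unif_mean_leaf U y v (G : {set {set V}} -> R) : v \in U -> y v = 0%N ->
  (2 < #|U|)%N -> (\sum_(j in U) y j + 2 = #|U|)%N ->
  unif_mean (trees_on U y) G =
  \sum_u leaf_weight U y u *
    unif_mean (trees_on (U :\ v) (decr_at y u)) (fun E => G ([set v; u] |: E)).
Proof.
move=> vU yv U2 yU; rewrite /unif_mean (sum_trees_on_leaf _ vU yv U2) mulr_sumr.
rewrite big_mkcond; apply: eq_bigr => u _.
have [/andP[uU yu]|uN] := ifPn; last first.
  rewrite /leaf_weight; case: ifPn uN => [uU|]; last by rewrite mul0r.
  by rewrite /=; case: (y u) => //; rewrite mul0r mul0r.
rewrite mulrA; congr (_ * _).
have yU' := sum_decr_at vU yv uU yu yU.
rewrite !card_trees_on // (pruefer_count_decr vU yv U2 uU yu) [in RHS]invfM mulrCA.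
rewrite divff ?mulr1 //; rewrite /leaf_weight uU mulf_neq0 //.
  by rewrite pnatr_eq0 -lt0n.
by rewrite invr_neq0 // pnatr_eq0 (cardsD1_subn2 vU U2).
Qed.

End LeafRecursion.

(** * Closed form of the mean, and the moment generating function bound *)

Section Mean.
Variables (R : realType) (V : finType) (phi : V -> R).
Implicit Types (U : {set V}) (y : V -> nat) (u v : V) (E : {set {set V}}).

Definition edge_sum E : R := \sum_(e in E) \prod_(j in e) phi j.

(* For #|U| > 2 the edge {j, k} occurs with probability
   (y j + y k) / (#|U| - 2). *)
Definition mean_edge_sum U y : R :=
  if #|U| == 2 then \prod_(j in U) phi j
  else ((\sum_(j in U) phi j) * (\sum_(j in U) (y j)%:R * phi j)
        - \sum_(j in U) (y j)%:R * phi j ^+ 2) / (#|U| - 2)%:R.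

Lemma edge_sum_leaf U y v u E : u != v -> E \in trees_on (U :\ v) y ->
  edge_sum ([set v; u] |: E) = phi v * phi u + edge_sum E.
Proof.
move=> uv /trees_onP[tE _]; rewrite /edge_sum big_setU1 /=; last exact: edge_notin tE.
by rewrite big_setU1 ?big_set1 //= inE eq_sym.
Qed.

Section Step.
Variables (U : {set V}) (y : V -> nat) (v : V).
Hypotheses (vU : v \in U) (yv : y v = 0%N) (U2 : (2 < #|U|)%N).
Hypothesis yU : (\sum_(j in U) y j + 2 = #|U|)%N.

Let cU : #|U| = #|U :\ v|.+1.
Proof. by rewrite (cardsD1 v U) vU. Qed.

(** The conditional mean of [edge_sum] given that [u] is the neighbour of [v], once
    [unif_mean_edge_sum] is known. *)
Definition leaf_mean u := phi v * phi u + mean_edge_sum (U :\ v) (decr_at y u).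

(** More than three vertices put [U :\ v] in the general branch of [mean_edge_sum]; as [y v = 0],
    the weighted sums over [U] only need a correction at [u]. *)
Lemma leaf_meanE u : u \in U -> (0 < y u)%N -> (3 < #|U|)%N ->
  leaf_mean u = phi v * phi u +
   ((\sum_(j in U :\ v) phi j) * (\sum_(j in U) (y j)%:R * phi j - phi u)
    - (\sum_(j in U) (y j)%:R * phi j ^+ 2 - phi u ^+ 2)) / (#|U| - 3)%:R.
Proof.
move=> uU yu U3; have uv := nleaf yv yu; rewrite /leaf_mean /mean_edge_sum.
have E (f : V -> R) : \sum_(j in U :\ v) (decr_at y u j)%:R * f j =
    \sum_(j in U) (y j)%:R * f j - f u.
  rewrite (big_decr yv (fun j m => m%:R * f j) uU yu).
  rewrite [in RHS](big_setD1 v) //= yv mul0r add0r.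
  rewrite [in RHS](big_setD1 u) /=; last by rewrite !inE uv.
  by rewrite -{2}(prednK yu) -natr1; ring.
have cU' : #|U :\ v| == 2 = false.
  by apply/negbTE; rewrite gtn_eqF // -ltnS -cU.
by rewrite cU' !E cU subSS.
Qed.

Lemma sum_leaf_mean : \sum_u leaf_weight R U y u * leaf_mean u = mean_edge_sum U y.
Proof.
have sE (f : V -> R) : \sum_u leaf_weight R U y u * f u =
    (\sum_(u in U) (y u)%:R * f u) / (#|U| - 2)%:R.
  rewrite [in RHS]big_mkcond mulr_suml; apply: eq_bigr => u _.
  by rewrite /leaf_weight; case: ifP; rewrite ?mul0r // => _; rewrite mulrAC.
rewrite {}sE /mean_edge_sum gtn_eqF //; congr (_ / _).
set Y1 := \sum_(j in U) (y j)%:R * phi j.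
set Y2 := \sum_(j in U) (y j)%:R * phi j ^+ 2.
(* With three vertices, removing [v] lands in the two-vertex branch; the [y j] then sum to 1, so a
   single neighbour [u] carries all the weight. *)
have [U3|U3] := leqP #|U| 3.
  have {U3} U3 : #|U| = 3 by apply/eqP; rewrite eqn_leq U3.
  have y1 : (\sum_(j in U) y j = 1)%N by apply/eqP; rewrite -(eqn_add2r 2) yU U3.
  have [u uU yu] : exists2 u, u \in U & (0 < y u)%N.
    have [u /andP[]|h] := pickP (fun u => (u \in U) && (0 < y u)%N); first by exists u.
    move: y1; rewrite big1 // => j jU; apply/eqP; rewrite -leqn0 leqNgt.
    by have := h j; rewrite jU /= => ->.
  have uv := nleaf yv yu.
  have [yu1 yN] : y u = 1%N /\ forall j, j \in U -> j != u -> y j = 0%N.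
    move: y1; rewrite (big_setD1 u) //=; case: (y u) yu => // -[|k] _ // [].
    move=> /eqP; rewrite add0n sum_nat_eq0 => /forall_inP h; split=> // j jU ju.
    by apply/eqP/h; rewrite !inE ju.
  have sE (f : V -> R) : \sum_(j in U) (y j)%:R * f j = f u.
    rewrite (big_setD1 u) //= yu1 mul1r big1 ?addr0 // => j.
    by rewrite !inE => /andP[ju jU]; rewrite yN // mul0r.
  rewrite /Y1 /Y2 !sE /leaf_mean /mean_edge_sum.
  have uUv : u \in U :\ v by rewrite !inE uv.
  have : #|U :\ v| == 2 by rewrite -eqSS -cU U3.
  move=> ->; rewrite (big_setD1 v vU) /= !(big_setD1 u uUv) /=.
  have : #|U :\ v :\ u| == 1%N.
    by rewrite -2!eqSS; move: U3; rewrite cU (cardsD1 u) uUv => ->.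
  by case/cards1P => w ->; rewrite !big_set1; ring.
set S := \sum_(j in U :\ v) phi j; set k : R := (#|U| - 3)%:R.
have k0 : k != 0 by rewrite pnatr_eq0 subn_eq0 -ltnNge.
have y2 : \sum_(j in U) (y j)%:R = k + 1.
  rewrite -natr_sum; have -> : (\sum_(j in U) y j = (#|U| - 3).+1)%N.
    by apply/eqP; rewrite -(eqn_add2r 2) yU addSnnS subnK.
  by rewrite -natr1.
(* Grouped so that each piece sums to [Y1], [Y2] or the total [k + 1]; vertices with [y u = 0], to
   which [leaf_meanE] does not apply, contribute zero. *)
transitivity (\sum_(u in U) ((phi v - S / k) * ((y u)%:R * phi u)
    + (y u)%:R * phi u ^+ 2 / k + (S * Y1 - Y2) / k * (y u)%:R)).
  apply: eq_bigr => u uU; have [|yu] := posnP (y u).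
    by move=> ->; rewrite mulr0n; ring.
  by rewrite leaf_meanE // -/Y1 -/Y2 -/S -/k; field.
rewrite !big_split /= -!mulr_sumr -mulr_suml y2 -/Y1 -/Y2 (big_setD1 v vU) /= -/S.
by field.
Qed.

(* Moving the leaf [v] from [u'] to [u] changes the conditional mean by this
   product; all other terms cancel because #|U| - 3 vertices remain. *)
Lemma leaf_meanB u u' : u \in U -> u' \in U -> u != u' ->
  (0 < y u)%N -> (0 < y u')%N ->
  (3 < #|U|)%N /\
  leaf_mean u - leaf_mean u' = (phi u - phi u') *
    (phi v - (\sum_(j in U :\ v :\ u :\ u') phi j) / (#|U| - 3)%:R).
Proof.
move=> uU u'U uu' yu yu'.
have U3 : (3 < #|U|)%N.
  rewrite -yU -[4%N]/(2 + 2)%N leq_add2r (big_setD1 u) //= (big_setD1 u') /=; last first.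
    by rewrite !inE eq_sym uu'.
  by case: (y u) yu => // a _; case: (y u') yu' => // b _; rewrite !addSn addnS.
split=> //; rewrite !leaf_meanE //.
have uv := nleaf yv yu; have u'v := nleaf yv yu'.
rewrite (big_setD1 u) /=; last by rewrite !inE uv.
rewrite (big_setD1 u') /=; last by rewrite !inE u'v eq_sym uu'.
have : (#|U| - 3)%:R != 0 :> R by rewrite pnatr_eq0 subn_eq0 -ltnNge.
by move=> k0; field.
Qed.
End Step.

Lemma unif_mean_edge_sum U y : (\sum_(j in U) y j + 2 = #|U|)%N ->
  unif_mean (trees_on U y) edge_sum = mean_edge_sum U y.
Proof.
move: U y; apply: leaf_ind => [U y U2 y0|U y v vU yv U2 yU IH].
  rewrite trees_on2 // /unif_mean cards1 invr1 mul1r big_set1 /edge_sum big_set1.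
  by rewrite /mean_edge_sum U2.
rewrite (unif_mean_leaf _ vU yv U2 yU) -(sum_leaf_mean vU yv U2 yU).
apply: eq_bigr => u _; have := leaf_weight_ge0 R U y u; rewrite le_eqVlt.
case/predU1P => [<-|/leaf_weight_gt0[uU yu]]; first by rewrite !mul0r.
have yU' := sum_decr_at vU yv uU yu yU; congr (_ * _).
rewrite /leaf_mean -IH // /unif_mean.
under eq_bigr => E ET do rewrite (edge_sum_leaf (nleaf yv yu) ET).
rewrite big_split /= sumr_const mulrDr -(mulr_natl (phi v * phi u)) mulKf //.
by rewrite (card_trees_on R yU') gt_eqF ?pruefer_count_gt0.
Qed.

(** [B] is a potential bounding the remaining squared ranges: removing [v] spends [B U - B (U :\ v)]
    in Hoeffding's lemma, and these amounts telescope. Keeping [B] abstract lets both terms of the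
    minimum in [Lphi] share one induction. *)
Lemma unif_mean_expR_le (B : {set V} -> R) (z : R) :
  (forall U, 0 <= B U) ->
  (forall U v, v \in U -> B (U :\ v) <= B U) ->
  (forall U v u u', v \in U -> u \in U :\ v -> u' \in U :\ v :\ u ->
     (3 < #|U|)%N ->
     ((phi u - phi u') *
      (phi v - (\sum_(j in U :\ v :\ u :\ u') phi j) / (#|U| - 3)%:R)) ^+ 2
     <= B U - B (U :\ v)) ->
  forall U y, (\sum_(j in U) y j + 2 = #|U|)%N ->
  unif_mean (trees_on U y) (fun E => expR (z * edge_sum E)) <=
  expR (z * mean_edge_sum U y + z ^+ 2 * B U / 8).
Proof.
move=> B0 Bmono Bstep; apply: leaf_ind => [U y U2 y0|U y v vU yv U2 yU IH].
  rewrite trees_on2 // /unif_mean cards1 invr1 mul1r big_set1 /edge_sum big_set1.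
  by rewrite /mean_edge_sum U2 /= ler_expR lerDl divr_ge0 // mulr_ge0 // sqr_ge0.
rewrite (unif_mean_leaf _ vU yv U2 yU).
set c := z ^+ 2 * B (U :\ v) / 8.
apply: (@le_trans _ _
  (\sum_u leaf_weight R U y u * expR (z * leaf_mean U y v u) * expR c)).
  apply: ler_sum => u _; rewrite -mulrA.
  have := leaf_weight_ge0 R U y u; rewrite le_eqVlt.
  case/predU1P => [<-|/[dup] w0 /leaf_weight_gt0[uU yu]]; first by rewrite !mul0r.
  rewrite ler_pM2l // /unif_mean.
  under eq_bigr => E ET do
    rewrite (edge_sum_leaf (nleaf yv yu) ET) mulrDr expRD.
  rewrite -mulr_sumr mulrCA -expRD /leaf_mean mulrDr -addrA expRD.
  by rewrite ler_pM2l ?expR_gt0 //; exact: IH.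
rewrite -mulr_suml.
have := @hoeffding R V (leaf_weight R U y) (leaf_mean U y v) z (B U - B (U :\ v))
  (leaf_weight_ge0 R U y) (sum_leaf_weight R U2 yU).
rewrite (sum_leaf_mean vU yv U2 yU) => H.
apply: le_trans (_ : expR (z * mean_edge_sum U y + z ^+ 2 * (B U - B (U :\ v)) / 8)
   * expR c <= _).
  rewrite ler_pM2r ?expR_gt0 //; apply: H => u u' /leaf_weight_gt0[uU yu].
  move=> /leaf_weight_gt0[u'U yu']; have [->|uu'] := eqVneq u u'.
    (* Equal candidates have range zero, so monotonicity of [B] is what is required here. *)
    by rewrite subrr expr0n /= subr_ge0 Bmono.
  have [U3 ->] := leaf_meanB vU yv yU uU u'U uu' yu yu'.
  by apply: Bstep; rewrite ?inE ?(nleaf yv yu) ?(nleaf yv yu') // eq_sym uu'.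
by rewrite -expRD ler_expR /c; lra.
Qed.
End Mean.

(** * Harmonic numbers against the logarithm *)

Definition harmonic_number (R : realType) (k : nat) : R :=
  \sum_(i < k) i.+1%:R^-1.

Lemma harmonic_number_le_ln (R : realType) (k n : nat) : (0 < n)%N -> (k <= n)%N ->
  harmonic_number R k <= ln n%:R + 1.
Proof.
move=> n0; case: k => [_|k kn].
  by rewrite /harmonic_number big_ord0 addr_ge0 // ln_ge0 // ler1n.
apply: (@le_trans _ _ (ln k.+1%:R + 1)); last first.
  by rewrite lerD2r ler_ln ?posrE ?ltr0n // ler_nat.
elim: k {kn} => [|k IH].
  by rewrite /harmonic_number big_ord1 ln1 add0r invr1.
rewrite /harmonic_number big_ord_recr /=.
have k2 : 0 < k.+2%:R :> R by rewrite ltr0n.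
(* This says that the new harmonic term is at most [ln (k + 2) - ln (k + 1)]. *)
have : ln (1 + (- k.+2%:R^-1)) <= - k.+2%:R^-1 :> R.
  by apply: le_ln1Dx; rewrite ltrN2 invf_lt1 // ltr1n.
have -> : 1 + - k.+2%:R^-1 = k.+1%:R / k.+2%:R :> R.
  by rewrite -[in RHS]natr1 -[in RHS]addn1; field.
rewrite ln_div ?posrE ?ltr0n // => h.
apply: (le_trans (lerD IH (lexx _))).
by rewrite addrAC lerD2r -lerBrDr; move: h; rewrite lerBlDr addrC.
Qed.

(** * The two potentials behind the two terms of [Lphi] *)

Section Bounds.
Variables (R : realType) (V : finType) (phi : V -> R) (a b c : R).
Hypotheses (ab : a < b) (phiab : forall j, a <= phi j <= b).
Implicit Types (U : {set V}) (u v : V).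

Definition abs_dev_on U : R := \sum_(j in U) `|phi j - c|.

Definition card_bound U : R := (b - a) ^+ 4 * #|U|%:R.

(** Each vertex pays its deviation from [c] once when removed, and a share [1 / (m - 3)] of it
    whenever another leaf is removed earlier from [m > 3] vertices; the shares add up to at most the
    harmonic number. *)
Definition dev_bound U : R :=
  (b - a) ^+ 3 * (abs_dev_on U * (1 + harmonic_number R (#|U| - 3))).

Let d0 : 0 <= b - a. Proof. by rewrite subr_ge0 ltW. Qed.

Lemma abs_dev_on_ge0 U : 0 <= abs_dev_on U.
Proof. exact: sumr_ge0. Qed.

Lemma harmonic_number_ge0 k : 0 <= harmonic_number R k.
Proof. by apply: sumr_ge0 => i _; rewrite invr_ge0. Qed.

Lemma harmonic_number_homo k l : (k <= l)%N -> harmonic_number R k <= harmonic_number R l.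
Proof.
move=> /subnK <-; elim: (l - k)%N => [|m IH] //.
by rewrite addSn {2}/harmonic_number big_ord_recr /= (le_trans IH) // lerDl invr_ge0.
Qed.

Lemma card_bound_ge0 U : 0 <= card_bound U.
Proof. by rewrite mulr_ge0 ?exprn_ge0. Qed.

Lemma dev_bound_ge0 U : 0 <= dev_bound U.
Proof.
apply: mulr_ge0; first exact: exprn_ge0.
by rewrite mulr_ge0 ?abs_dev_on_ge0 // addr_ge0 // harmonic_number_ge0.
Qed.

Lemma card_bound_mono U v : v \in U -> card_bound (U :\ v) <= card_bound U.
Proof.
by move=> vU; rewrite ler_wpM2l ?exprn_ge0 // ler_nat subset_leq_card // subD1set.
Qed.

Lemma dev_bound_mono U v : v \in U -> dev_bound (U :\ v) <= dev_bound U.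
Proof.
move=> vU; rewrite ler_wpM2l ?exprn_ge0 // ler_pM ?abs_dev_on_ge0 //.
- by rewrite addr_ge0 ?harmonic_number_ge0.
- by rewrite [leRHS](big_setD1 v) //= lerDr.
- rewrite lerD2l harmonic_number_homo // leq_sub2r //.
  by rewrite subset_leq_card // subD1set.
Qed.

Section Step.
Variables (U : {set V}) (v u u' : V).
Hypotheses (vU : v \in U) (uU : u \in U :\ v) (u'U : u' \in U :\ v :\ u).
Hypothesis U3 : (3 < #|U|)%N.

Let A := U :\ v :\ u :\ u'.
Let k : R := (#|U| - 3)%:R.
Let Z := phi v - (\sum_(j in A) phi j) / k.

Let cA : #|U| = (#|A|).+3.
Proof. by rewrite (cardsD1 v U) vU (cardsD1 u) uU (cardsD1 u') u'U. Qed.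

Let k0 : 0 < k. Proof. by rewrite ltr0n subn_gt0. Qed.

Let kE : k = #|A|%:R. Proof. by rewrite /k cA -[_.+3]addn3 addnK. Qed.

Let Z_le : `|Z| <= b - a.
Proof.
have Ak : \sum_(j in A) 1 = k :> R by rewrite sumr_const -kE.
have /andP[va vb] := phiab v.
have h1 : a <= (\sum_(j in A) phi j) / k.
  rewrite ler_pdivlMr // -Ak mulr_sumr; apply: ler_sum => j _.
  by rewrite mulr1; have /andP[] := phiab j.
have h2 : (\sum_(j in A) phi j) / k <= b.
  rewrite ler_pdivrMr // -Ak mulr_sumr; apply: ler_sum => j _.
  by rewrite mulr1; have /andP[] := phiab j.
by rewrite ler_norml /Z; lra.
Qed.

Let Z_dev : `|Z| <= `|phi v - c| + abs_dev_on (U :\ v) / k.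
Proof.
have -> : Z = (phi v - c) - (\sum_(j in A) (phi j - c)) / k.
  rewrite big_split /= sumr_const -[_ *+ #|_|]mulr_natr -kE /Z; field.
  exact: lt0r_neq0.
apply: (le_trans (ler_normB _ _)); rewrite lerD2l normrM normfV (gtr0_norm k0).
rewrite ler_pM2r ?invr_gt0 //; apply: (le_trans (ler_norm_sum _ _ _)).
rewrite /abs_dev_on (big_setD1 u uU) /= (big_setD1 u' u'U) /= -/A.
by rewrite addrA lerDr addr_ge0.
Qed.

Let phiB_le : `|phi u - phi u'| <= b - a.
Proof.
have /andP[ua ub] := phiab u; have /andP[u'a u'b] := phiab u'.
by rewrite ler_norml; lra.
Qed.

Lemma card_bound_step : ((phi u - phi u') * Z) ^+ 2 <= card_bound U - card_bound (U :\ v).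
Proof.
have -> : card_bound U - card_bound (U :\ v) = ((b - a) * (b - a)) ^+ 2.
  by rewrite /card_bound (cardsD1 v U) vU add1n -natr1; ring.
rewrite -real_normK ?num_real // lerXn2r ?nnegrE ?mulr_ge0 //.
by rewrite normrM ler_pM.
Qed.

Lemma dev_bound_step : ((phi u - phi u') * Z) ^+ 2 <= dev_bound U - dev_bound (U :\ v).
Proof.
(* Of the four factors in the square, three are bounded by [b - a], and only one copy of [Z] uses
   the finer estimate [Z_dev]. *)
apply: (@le_trans _ _ ((b - a) ^+ 3 * (`|phi v - c| + abs_dev_on (U :\ v) / k))).
  rewrite -real_normK ?num_real // normrM exprMn.
  apply: (@le_trans _ _ ((b - a) ^+ 2 * (b - a) * `|Z|)); last first.
    by rewrite -exprSr ler_wpM2l ?exprn_ge0.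
  rewrite -mulrA ler_pM ?sqr_ge0 // ?lerXn2r ?nnegrE //.
  by rewrite expr2 ler_wpM2r.
rewrite -mulrBr ler_wpM2l ?exprn_ge0 // {2}/abs_dev_on (big_setD1 v vU) /=.
rewrite -/(abs_dev_on (U :\ v)).
have -> : (#|U :\ v| - 3 = #|A|.-1)%N.
  move: cA; rewrite (cardsD1 v U) vU /= add1n => -[->].
  by case: #|A| => [|m] //; rewrite subSS subn2.
have A0 : (0 < #|A|)%N by move: k0; rewrite kE ltr0n.
rewrite cA -[_.+3]addn3 addnK.
(* The harmonic numbers of the two potentials differ by [k^-1], which pays for the averaged
   deviation; the surplus is [|phi v - c| (h + 1/k)]. *)
have -> : harmonic_number R #|A| = harmonic_number R #|A|.-1 + k^-1.
  by rewrite kE -{1 3}(prednK A0) {1}/harmonic_number big_ord_recr.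
have := harmonic_number_ge0 #|A|.-1.
set h := harmonic_number _ _ => h0.
have ik : 0 <= k^-1 by rewrite invr_ge0 ltW.
have := mulr_ge0 (normr_ge0 (phi v - c)) (addr_ge0 h0 ik).
by lra.
Qed.
End Step.
End Bounds.

(** * Jensen and Chernoff bounds for a uniform random element *)

Section Concentration.
Variables (R : realType) (T : finType) (A : {set T}) (f : T -> R) (m L : R).
Hypothesis A0 : (0 < #|A|)%N.
Hypothesis L0 : 0 <= L.
Hypothesis mgf : forall z, unif_mean A (fun t => expR (z * f t)) <=
  expR (z * m + z ^+ 2 * L / 8).

Let cA : 0 < #|A|%:R :> R. Proof. by rewrite ltr0n. Qed.

(** Jensen's inequality, by averaging the tangent of the exponential at [z * m]. *)
Lemma unif_mean_expR_ge z : unif_mean A f = m ->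
  expR (z * m) <= unif_mean A (fun t => expR (z * f t)).
Proof.
move=> fm; rewrite /unif_mean [leRHS]mulrC ler_pdivlMr //.
have -> : expR (z * m) * #|A|%:R = \sum_(t in A) expR (z * m) * (1 + (z * f t - z * m)).
  rewrite -mulr_sumr big_split /= sumrB -mulr_sumr !sumr_const; congr (_ * _).
  rewrite -[\sum_(t in A) f t](mulVKf (lt0r_neq0 cA)) -/(unif_mean A f) fm.
  by rewrite -[_ *+ #|A|]mulr_natr; ring.
apply: ler_sum => t _.
have -> : expR (z * f t) = expR (z * m) * expR (z * f t - z * m).
  by rewrite -expRD; congr expR; ring.
by rewrite ler_wpM2l ?expR_ge0 // expR_ge1Dx.
Qed.

(** Markov's inequality for [expR (z * f t)]; the sign of [z] selects the tail. *)
Lemma chernoff z s (P : pred T) : (forall t, P t -> s <= z * (f t - m)) ->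
  unif_prob R A P <= expR (z ^+ 2 * L / 8 - s).
Proof.
move=> Ps; rewrite /unif_prob ler_pdivrMr //.
have := mgf z; rewrite /unif_mean [leLHS]mulrC ler_pdivrMr // => h.
rewrite -(ler_pM2l (expR_gt0 (z * m + s))) mulrA -expRD.
rewrite (_ : z * m + s + _ = z * m + z ^+ 2 * L / 8); last by ring.
apply: le_trans h; rewrite mulr_natr -sumr_const.
rewrite big_mkcond [leRHS]big_mkcond /=; apply: ler_sum => t _; rewrite inE.
case: (t \in A) => //=; case: ifP => Pt; last exact: expR_ge0.
by rewrite ler_expR; have := Ps t Pt; lra.
Qed.

Lemma unif_prob_dev_le s : 0 < s ->
  unif_prob R A (fun t => s < `|f t - m|) <=
    if L == 0 then 0 else 2 * expR (- (2 * s ^+ 2 / L)).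
Proof.
move=> s0.
have PU : unif_prob R A (fun t => s < `|f t - m|) <=
    unif_prob R A (fun t => s < f t - m) + unif_prob R A (fun t => s < - (f t - m)).
  rewrite /unif_prob -mulrDl ler_pM2r ?invr_gt0 // -natrD ler_nat.
  apply: leq_trans (leq_card_setU _ _); apply: subset_leq_card.
  apply/subsetP => t; rewrite !inE => /andP[-> /=].
  by rewrite ltr_normr.
have P2 z : 0 <= z -> unif_prob R A (fun t => s < `|f t - m|) <=
    2 * expR (z ^+ 2 * L / 8 - z * s).
  move=> z0; apply: (le_trans PU); rewrite mulrDl mul1r; apply: lerD.
    by apply: chernoff => t st; rewrite ler_wpM2l // ltW.
  rewrite -(sqrrN z); apply: chernoff => t st.
  by rewrite mulNr -mulrN ler_wpM2l // ltW.
case: eqP => [L00|/eqP Ln]; last first.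
  have Lp : 0 < L by rewrite lt_neqAle eq_sym Ln.
  (* This [z] minimises [z ^+ 2 * L / 8 - z * s]. *)
  have := P2 (4 * s / L); rewrite divr_ge0 ?mulr_ge0 ?(ltW s0) // => /(_ isT).
  by congr (_ <= 2 * expR _); field.
(* For [L = 0] every [z >= 0] gives [p <= 2 * expR (- (z * s))]. If [p > 0], taking [z = 2 / (p s)]
   contradicts [p * expR (2 / p) >= p + 2]. *)
rewrite leNgt; apply/negP => p0; set p := unif_prob _ _ _ in P2 p0.
have := P2 (2 / p / s); rewrite L00 mulr0 mul0r sub0r !divr_ge0 ?(ltW p0) ?(ltW s0) //.
move=> /(_ isT); rewrite divfK ?lt0r_neq0 // expRN.
have e0 := expR_gt0 (2 / p); rewrite ler_pdivlMr //.
have := expR_ge1Dx (2 / p) => h; apply/negP; rewrite -ltNge.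
apply: (@lt_le_trans _ _ (p * (1 + 2 / p))); last by rewrite ler_pM2l.
by rewrite mulrDr mulr1 mulrC divfK ?lt0r_neq0 // ltrDr.
Qed.
End Concentration.

(** * Transfer to trees on all vertices with prescribed degrees *)

Lemma trees_with_degreesE (n : nat) (x : 'I_n -> nat) : (forall j, 0 < x j)%N ->
  trees_with_degrees x = trees_on [set: 'I_n] (fun j => (x j).-1).
Proof.
move=> x0; apply/setP => E; rewrite inE; apply/asboolP/trees_onP.
  move=> [[sE cE aE] dE]; split; last by move=> j _; rewrite dE prednK.
  by split=> // e eE; rewrite subsetT sE.
move=> [[sE cE aE] dE]; split; last by move=> j; rewrite dE ?inE // prednK.
by split=> // [e /sE[]//|j k]; apply: cE; rewrite inE.
Qed.

(** [Lphi] vanishes for constant [phi]; division by zero would turn the tail bound into the trivial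
    2, so the limiting value 0 is stated separately. *)
Theorem theorem3p1 (R : realType) (n : nat) (a b : R) (phi : 'I_n -> R)
    (x : 'I_n -> nat) :
  (2 <= n)%N ->
  a < b ->
  (forall j, a <= phi j <= b) ->
  tree_degree_sequence x ->
  (forall xi : R, xi = -1 \/ xi = 1 ->
     exists K : R,
       0 <= K <= 8^-1 * Lphi phi a b /\
       unif_mean (trees_with_degrees x) (fun T => expR (xi * F phi T))
         = expR (xi * Fbar phi x + K)) /\
  (forall t : R, 0 < t ->
     unif_prob R (trees_with_degrees x) (fun T => t < `|F phi T - Fbar phi x|)
       <= if Lphi phi a b == 0 then 0
          else 2 * expR (- (2 * t ^+ 2 / Lphi phi a b))).
Proof.
move=> n2 ab phiab [x0 xsum].
(* The centre [c] attaining [normm] is the one used in [dev_bound]. *)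
have [c [cE _]] := normm_min phi.
have n0 : (0 < n)%N by apply: ltnW.
pose y j := (x j).-1.
have yT : (\sum_(j in [set: 'I_n]) y j + 2 = #|[set: 'I_n]|)%N.
  rewrite cardsT card_ord (eq_bigl predT) => [|j]; last by rewrite inE.
  have : (\sum_(j < n) x j = \sum_(j < n) y j + n)%N.
    rewrite -[X in (_ + X)%N]card_ord -sum1_card -big_split /=.
    by apply: eq_bigr => j _; rewrite addn1 /y prednK.
  rewrite xsum mul2n -addnn => h; apply/eqP; rewrite -(eqn_add2r n) addnAC -h.
  by rewrite subnK // (leq_trans n2) // leq_addl.
have TE := trees_with_degreesE x0; set A := trees_with_degrees x in TE *.
have A0 : (0 < #|A|)%N.
  by rewrite TE -(ltr0n R) (card_trees_on R yT) pruefer_count_gt0.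
have FE : Fbar phi x = mean_edge_sum phi [set: 'I_n] y.
  by rewrite -unif_mean_edge_sum // /Fbar -/A TE.
have nm0 : 0 <= normm phi by rewrite cE sumr_ge0.
have d0 : 0 <= b - a by rewrite subr_ge0 ltW.
have ln0 : 0 <= ln n%:R :> R by rewrite ln_ge0 // ler1n.
have L0 : 0 <= Lphi phi a b.
  by rewrite mulr_ge0 ?exprn_ge0 // le_min !mulr_ge0 // addr_ge0.
have mgf z : unif_mean A (fun T => expR (z * F phi T)) <=
    expR (z * Fbar phi x + z ^+ 2 * Lphi phi a b / 8).
  (* Whichever term attains the minimum decides which potential is used. *)
  rewrite FE TE /Lphi minEle; case: ifP => _.
    apply: (le_trans (unif_mean_expR_le z (card_bound_ge0 ab)
      (card_bound_mono ab) (card_bound_step ab phiab) yT)).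
    by rewrite /card_bound cardsT card_ord ler_expR exprSr !mulrA.
  apply: (le_trans (unif_mean_expR_le z (dev_bound_ge0 phi c ab)
    (dev_bound_mono phi c ab) (dev_bound_step c ab phiab) yT)).
  rewrite ler_expR lerD2l ler_pM2r ?invr_gt0 // ler_wpM2l ?sqr_ge0 //.
  rewrite ler_wpM2l ?exprn_ge0 // cardsT card_ord.
  have -> : abs_dev_on phi c [set: 'I_n] = normm phi.
    by rewrite cE; apply: eq_bigl => j; rewrite inE.
  rewrite ler_wpM2l //.
  by have := harmonic_number_le_ln R n0 (leq_subr 3 n); lra.
split=> [xi xiE|t t0]; last exact: unif_prob_dev_le.
have xi2 : xi ^+ 2 = 1 by case: xiE => ->; rewrite ?sqrrN expr1n.
set M := unif_mean _ _.
have M1 : expR (xi * Fbar phi x) <= M by apply: unif_mean_expR_ge.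
have M0 : 0 < M by apply: lt_le_trans M1; exact: expR_gt0.
(* Jensen's inequality makes this nonnegative, and [mgf] at [z = xi] with [xi ^+ 2 = 1] bounds it
   above. *)
exists (ln M - xi * Fbar phi x); split; last by rewrite addrC subrK lnK.
apply/andP; split; first by rewrite subr_ge0 -ler_expR lnK.
rewrite lerBlDl -ler_expR lnK //; apply: le_trans (mgf xi) _.
by rewrite xi2 mul1r [_ / 8]mulrC.
Qed.
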